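(* Let $\alpha\in(0,1)$, $1<\gamma<1/(1-\alpha)$, $M(i,q)=\gamma^i$ for $(i,q)\in S$, and let $u_M$ satisfy $u_M\ge\sup_{\phi\in\Phi}\sup_{x\in S}|c^\phi(x)|/M(x)$. For $\epsilon>0$ and $i\in\mathbb{N}_0$ let $$n_{\epsilon,i}=\Big\lceil\log_{(1-\alpha)\gamma}\Big(\frac{\epsilon(1-(1-\alpha)\gamma)}{2u_M\gamma^i}\Big)\Big\rceil .$$ Then: (1) $\big|\big(V_{\alpha,n_{\epsilon,i}}(i,0)-V_{\alpha,n_{\epsilon,i}}(i,1)\big)-s_\alpha(i)\big|\le\epsilon$. (2) The Value Iteration policy $\phi_{\alpha,n_{\epsilon/2,i}}$ is $\epsilon$-optimal for all starting states $(j,1)$ with $j\le i$, i.e. $\big|V_\alpha^{\phi_{\alpha,n_{\epsilon/2,i}}}(j,1)-V_\alpha(j,1)\big|\le\epsilon$ for all $0\le j\le i$.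
   Context: Model. Real parameters $\lambda,\beta>0$ and $0<\mu_1<\mu_2$ satisfy $\lambda+\mu_1+\mu_2+\beta=1$; service cost rates $0=c_{\mu_1}<c_{\mu_2}$; a fixed rate $\mu\in\{\mu_1,\mu_2\}$ with $\mu>\lambda$. The holding cost $h:\mathbb{N}_0\to\mathbb{R}$ satisfies $h(0)=0$, is non-negative, non-decreasing, convex, unbounded, and $\sum_{i\ge 0}h(i)x^i<\infty$ for all $0<x<1$. State space $S=\mathbb{N}_0\times\{0,1\}$. $\Phi$ is the set of stationary deterministic policies $\phi$, with $\phi(i,1)\in\{\mu_1,\mu_2\}$ and $\phi(i,0)=\mu$. Under $\phi$, the discrete-time Markov chain $(Y_n)$ on $S$ has the following transitions. From $(i,1)$ with $a=\phi(i,1)$: to $(i+1,1)$ w.p. $\lambda$, to $(i,0)$ w.p. $\beta$, to $(i-1,1)$ w.p. $a\mathbf 1_{\{i>0\}}$, to $(i,1)$ otherwise. From $(i,0)$: to $(i+1,0)$ w.p. $\lambda$, to $(i-1,0)$ w.p. $\mu\mathbf 1_{\{i>0\}}$, to $(i,0)$ otherwise. One-step costs: $c^\phi(i,1)=c_{\phi(i,1)}+h(i)$, $c^\phi(i,0)=c_\mu+h(i)$. $V^\phi_\alpha(x)=\mathbb{E}^\phi_x\big[\sum_{n\ge0}(1-\alpha)^nc^\phi(Y_n)\big]$ and $V_\alpha(x)=\inf_{\phi\in\Phi}V_\alpha^\phi(x)$. The expected discounted saved cost from queue length $i$ is $s_\alpha(i)=\sup_{\phi\in\Phi}\big(V_\alpha^\phi(i,0)-V_\alpha^\phi(i,1)\big)$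 (note $V^\phi_\alpha(i,0)$ does not depend on $\phi$). Write $i^+=\max\{i,0\}$. Value Iteration. $V_{\alpha,0}\equiv0$ and, for $n\ge 0$, $$V_{\alpha,n+1}(i,1)=h(i)+(1-\alpha)\big(\mu_1V_{\alpha,n}(i,1)+\mu_1V_{\alpha,n}((i-1)^+,1)+\lambda V_{\alpha,n}(i+1,1)+\beta V_{\alpha,n}(i,0)\big)+\min_{a\in\{\mu_1,\mu_2\}}\big\{c_a+(1-\alpha)\big((a-\mu_1)V_{\alpha,n}((i-1)^+,1)+(\mu_2-a)V_{\alpha,n}(i,1)\big)\big\},$$ $$V_{\alpha,n+1}(i,0)=c_\mu+h(i)+(1-\alpha)\big(\mu V_{\alpha,n}((i-1)^+,0)+(1-\mu-\lambda)V_{\alpha,n}(i,0)+\lambda V_{\alpha,n}(i+1,0)\big).$$ $\phi_{\alpha,n+1}(i,1)$ is the minimising action $a$ in the first formula (ties resolved in favour of $\mu_1$). *)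

(* Defs.v *)
From HB Require Import structures.
From mathcomp Require Import all_boot all_order all_algebra.
From mathcomp Require Import all_classical all_reals all_analysis.
Set Implicit Arguments.
Unset Strict Implicit.
Unset Printing Implicit Defensive.
Import Order.TTheory GRing.Theory Num.Theory.
Import numFieldNormedType.Exports.
Local Open Scope classical_set_scope.
Local Open Scope ring_scope.

(* (i, true) and (i, false) are the states written (i, 1) and (i, 0). *)
Definition state : Type := (nat * bool)%type.

(* [srate a] is c_a; it is only relevant at a = mu1 and a = mu2. *)
Record model (R : realType) := Model {
  lambda : R; beta : R; mu1 : R; mu2 : R; mu : R;
  srate : R -> R;
  hold : nat -> R;
  lambda_gt0 : 0 < lambda;
  beta_gt0 : 0 < beta;
  mu1_gt0 : 0 < mu1;
  mu1_lt_mu2 : mu1 < mu2;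
  total_rate : lambda + mu1 + mu2 + beta = 1;
  srate_mu1 : srate mu1 = 0;
  srate_mu2 : 0 < srate mu2;
  mu_mem : mu = mu1 \/ mu = mu2;
  mu_gt_lambda : lambda < mu;
  hold0 : hold 0%N = 0;
  hold_ge0 : forall i, 0 <= hold i;
  hold_nondecreasing : {homo hold : i j / (i <= j)%N >-> i <= j};
  hold_convex : forall i, hold i.+1 - hold i <= hold i.+2 - hold i.+1;
  hold_unbounded : forall B : R, exists i, B < hold i;
  hold_summable : forall x : R, 0 < x -> x < 1 ->
    cvgn (series (fun i => hold i * x ^+ i)) }.

Section defs.
Context {R : realType} (m : model R).

Definition policies : set (state -> R) :=
  [set phi | forall i, (phi (i, true) = mu1 m \/ phi (i, true) = mu2 m) /\
                       phi (i, false) = mu m].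

Definition cost (phi : state -> R) (x : state) : R :=
  srate m (phi x) + hold m x.1.

(* One-step transition probabilities. When i = 0 the departure term has
   coefficient 0, so the truncated predecessor i.-1 is harmless. *)
Definition trans (phi : state -> R) (x y : state) : R :=
  let i := x.1 in
  let a := phi x * (0 < i)%N%:R in
  if x.2 then
    lambda m * (y == (i.+1, true))%:R + beta m * (y == (i, false))%:R
    + a * (y == (i.-1, true))%:R
    + (1 - lambda m - beta m - a) * (y == (i, true))%:R
  else
    lambda m * (y == (i.+1, false))%:R
    + a * (y == (i.-1, false))%:R
    + (1 - lambda m - a) * (y == (i, false))%:R.

Definition markov_chain d (T : measurableType d) (P : probability T R)
    (Y : nat -> T -> state) (x : state) (p : state -> state -> R) : Prop :=
  [/\ forall n, measurable_fun [set: T] (Y n),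
      P [set w | Y 0%N w = x] = 1%E
    & forall (n : nat) (y : nat -> state),
        P [set w | forall k, (k <= n.+1)%N -> Y k w = y k] =
        (P [set w | forall k, (k <= n)%N -> Y k w = y k]
          * (p (y n) (y n.+1))%:E)%E].

(* [P phi x] plays the role of the law P^phi_x of the chain Y started at x.
   Costs are nonnegative, so the values below make sense in \bar R. *)
Section value.
Context d (T : measurableType d) (P : (state -> R) -> state -> probability T R).
Context (Y : nat -> T -> state) (alpha : R).

Definition policy_value (phi : state -> R) (x : state) : \bar R :=
  (\int[P phi x]_w
     \sum_(0 <= n <oo) ((1 - alpha) ^+ n * cost phi (Y n w))%:E)%E.

Definition value (x : state) : \bar R :=
  ereal_inf [set policy_value phi x | phi in policies].

Definition saved_cost (i : nat) : \bar R :=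
  ereal_sup [set (policy_value phi (i, false) - policy_value phi (i, true))%E
            | phi in policies].

End value.

Section value_iteration.
Variable alpha : R.

Definition vi_action_cost (V : state -> R) (i : nat) (a : R) : R :=
  srate m a + (1 - alpha) * ((a - mu1 m) * V (i.-1, true)
                             + (mu2 m - a) * V (i, true)).

Definition vi_step (V : state -> R) (x : state) : R :=
  let i := x.1 in
  if x.2 then
    hold m i
    + (1 - alpha) * (mu1 m * V (i, true) + mu1 m * V (i.-1, true)
                     + lambda m * V (i.+1, true) + beta m * V (i, false))
    + Num.min (vi_action_cost V i (mu1 m)) (vi_action_cost V i (mu2 m))
  else
    srate m (mu m) + hold m i
    + (1 - alpha) * (mu m * V (i.-1, false)
                     + (1 - mu m - lambda m) * V (i, false)
                     + lambda m * V (i.+1, false)).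

Definition vi_value (n : nat) : state -> R := iter n vi_step (fun=> 0).

Definition vi_greedy (V : state -> R) (x : state) : R :=
  if x.2 then
    if vi_action_cost V x.1 (mu1 m) <= vi_action_cost V x.1 (mu2 m)
    then mu1 m else mu2 m
  else mu m.

(* The policy phi_{alpha, n} is only specified for n >= 1; at n = 0, before any
   minimisation has been performed, every policy is admitted. *)
Definition is_vi_policy (n : nat) (phi : state -> R) : Prop :=
  if n is k.+1 then phi = vi_greedy (vi_value k) else policies phi.

End value_iteration.
End defs.

Definition weight {R : realType} (gamma : R) (x : state) : R := gamma ^+ x.1.

Definition logb {R : realType} (b x : R) : R := ln x / ln b.

(* A negative ceiling, which arises for large eps, is read as 0 iterations. *)
Definition n_iter {R : realType} (alpha gamma uM eps : R) (i : nat) : nat :=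
  let b := (1 - alpha) * gamma in
  absz (Num.max 0 (Num.ceil (logb b (eps * (1 - b) / (2 * uM * gamma ^+ i))))).

(* Main.v *)
Require Import Defs.
From HB Require Import structures.
From mathcomp Require Import all_boot all_order all_algebra.
From mathcomp Require Import all_classical all_reals all_analysis.
From mathcomp Require Import measurable_realfun ring lra.
Set Implicit Arguments.
Unset Strict Implicit.
Unset Printing Implicit Defensive.
Import Order.TTheory GRing.Theory Num.Theory.
Import numFieldNormedType.Exports.
Local Open Scope classical_set_scope.
Local Open Scope ring_scope.

(* Let b = (1 - alpha) * gamma < 1. Since the chain moves up by at most one
   step, each transition operator Q satisfies Q M <= gamma M, so the one-step
   operators V |-> c + (1 - alpha) Q V are b-contractions for the M-weighted norm.
   With dev_n = uM b^n / (1 - b) M, the n-step values V_n of Value Iteration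
   bound the value of every policy from below, and V_n + dev_n bounds the value
   of the greedy policy phi_n from above; n_iter is chosen so that
   dev_n <= eps / 2. Both claims follow, because in the states (i, false) all
   policies have the same n-step costs, namely V_n (i, false). The Markov chain
   enters only through E_x[f(Y_n)] = (Q^n f)(x). *)

(** * The countable state space: slicing measures and integrals by state *)

Definition nth_state (k : nat) : state := (k./2, odd k).
(** The inverse of [nth_state]; through this bijection, sums over states become series indexed by
    [nat]. *)
Definition state_rank (s : state) : nat := (s.2 + s.1.*2)%N.

Lemma nth_stateK : cancel nth_state state_rank.
Proof. by move=> k; rewrite /state_rank /= odd_double_half. Qed.

Lemma state_rankK : cancel state_rank nth_state.
Proof.
by case=> i b; rewrite /nth_state /state_rank /= half_bit_double oddD odd_double
  addbF; case: b.
Qed.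

(** The space is countable and its singletons are products of measurable singletons, so every
    function of the state is measurable. *)
Lemma state_measurable (A : set state) : measurable A.
Proof.
apply: countable_measurable; last exact: countableP.
move=> [i b]; have -> : [set (i, b)] = [set i] `*` [set b] :> set state.
  by apply/seteqP; split => -[j c] /=; [move=> [-> ->]|move=> [-> ->]].
exact: measurableX.
Qed.

Section state_valued.
Context (R : realType) d (T : measurableType d) (X : T -> state)
  (mX : measurable_fun [set: T] X).

Lemma preimage_state_measurable (A : set state) : measurable (X @^-1` A).
Proof. by rewrite -[_ @^-1` _]setTI; apply: mX => //; exact: state_measurable. Qed.

Lemma measurable_fun_state (f : state -> R) :
  measurable_fun [set: T] (fun w => (f (X w))%:E).
Proof.
move=> _ B mB; rewrite setTI.
exact: (preimage_state_measurable [set s | B (f s)%:E]).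
Qed.

Lemma bigcup_state (D : set T) :
  D = \bigcup_k (D `&` X @^-1` [set nth_state k]).
Proof.
rewrite -setI_bigcupr; apply/esym/setIidPl => w _.
by exists (state_rank (X w)) => //=; rewrite state_rankK.
Qed.

Lemma trivIset_state (D : set T) :
  trivIset setT (fun k => D `&` X @^-1` [set nth_state k]).
Proof.
by move=> i j _ _ [w [[_ /= ->] [_ /= /(can_inj nth_stateK)]]].
Qed.

Lemma measure_state (mu : probability T R) (D : set T) :
  measurable D ->
  mu D = (\sum_(k <oo) mu (D `&` X @^-1` [set nth_state k]))%E.
Proof.
move=> mD; rewrite [in LHS](bigcup_state D) measure_semi_bigcup//.
- by move=> k; apply: measurableI => //; exact: preimage_state_measurable.
- exact: trivIset_state.
- apply: bigcup_measurable => k _; apply: measurableI => //.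
  exact: preimage_state_measurable.
Qed.

Lemma ge0_integral_state (mu : probability T R) (D : set T)
    (g : T -> \bar R) :
  measurable D -> measurable_fun D g -> (forall w, 0 <= g w)%E ->
  (\int[mu]_(w in D) g w =
   \sum_(k <oo) \int[mu]_(w in D `&` X @^-1` [set nth_state k]) g w)%E.
Proof.
move=> mD mg g0; rewrite [in LHS](bigcup_state D) ge0_integral_bigcup//.
- by move=> k; apply: measurableI => //; exact: preimage_state_measurable.
- by rewrite -bigcup_state.
- exact: trivIset_state.
Qed.

Lemma integral_state (mu : probability T R) (D : set T)
    (f : state -> R) :
  measurable D -> (forall s, 0 <= f s) ->
  (\int[mu]_(w in D) (f (X w))%:E =
   \sum_(k <oo) ((f (nth_state k))%:E *
                 mu (D `&` X @^-1` [set nth_state k])))%E.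
Proof.
move=> mD f0; rewrite ge0_integral_state//; last 2 first.
- exact/measurable_funTS/measurable_fun_state.
- by move=> w; rewrite lee_fin.
apply: eq_eseriesr => k _; rewrite -integral_cst//; last first.
  by apply: measurableI => //; exact: preimage_state_measurable.
by apply: eq_integral => w /[!inE] -[_ /= ->].
Qed.

End state_valued.

Lemma nneseries_state_pred1 (R : realType) (f : state -> R) (s : state) :
  (forall s, 0 <= f s) ->
  (\sum_(k <oo) (f (nth_state k) * (nth_state k == s)%:R)%:E = (f s)%:E)%E.
Proof.
move=> f0; rewrite (@nneseriesD1 _ _ (state_rank s) xpredT)//; last first.
  by move=> k _; rewrite lee_fin mulr_ge0.
rewrite state_rankK eqxx mulr1 eseries0 ?adde0// => k _ kn.
case: eqP => [eks|_]; last by rewrite mulr0.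
by move: kn; rewrite -eks nth_stateK eqxx.
Qed.

(** * Law of two consecutive states of the chain *)

Section chain.
Context (R : realType) d (T : measurableType d) (P : probability T R)
  (Y : nat -> T -> state) (x : state) (p : state -> state -> R)
  (hY : markov_chain P Y x p).

Let mY n : measurable_fun [set: T] (Y n). Proof. by case: hY. Qed.

Lemma measurable_cylinder (y : nat -> state) (j n : nat) :
  measurable [set w | forall k, (j <= k <= n)%N -> Y k w = y k].
Proof.
(* The time bounds move into the target sets, so that the intersection runs over all of [nat]. *)
rewrite (_ : mkset _ =
  \bigcap_k (Y k @^-1` [set s | (j <= k <= n)%N -> s = y k])).
  by apply: bigcapT_measurable => k; exact: preimage_state_measurable.
by apply/seteqP; split => w /= h k; [move=> _ /=; exact: h|exact: (h k I)].
Qed.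

(* Induction on [j]: the constraint at time [j] is dropped by summing over the
   values of [Y j]; [j = 0] is the defining product formula. *)
Lemma markov_chain_cylinder (j n : nat) (y : nat -> state) : (j <= n)%N ->
  P [set w | forall k, (j <= k <= n.+1)%N -> Y k w = y k] =
  (P [set w | forall k, (j <= k <= n)%N -> Y k w = y k]
   * (p (y n) (y n.+1))%:E)%E.
Proof.
elim: j y => [|j IH] y jn; first by case: hY => _ _ /(_ n y).
pose z s k := if k == j then s else y k.
have cyl N s : (j <= N)%N ->
  [set w | forall k, (j < k <= N)%N -> Y k w = y k] `&` Y j @^-1` [set s] =
  [set w | forall k, (j <= k <= N)%N -> Y k w = z s k] :> set T.
  move=> jN; apply/seteqP; split => w /=.
    move=> [h1 h2] k /andP[jk kN]; rewrite /z; case: eqP => [->//|/eqP kj].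
    by apply: h1; rewrite ltn_neqAle eq_sym kj jk.
  move=> h; split; last by rewrite h /z ?eqxx// leqnn.
  by move=> k /andP[jk kN]; rewrite h /z ?(gtn_eqF jk)// ltnW.
rewrite (measure_state (mY j) P (measurable_cylinder _ _ _)).
rewrite (measure_state (mY j) P (measurable_cylinder y j.+1 n)).
rewrite muleC -nneseriesZl; last by [].
apply: eq_eseriesr => k _.
rewrite (cyl n.+1 _ (leqW (ltnW jn))) (cyl n _ (ltnW jn)).
rewrite (IH (z (nth_state k)) (ltnW jn)).
by rewrite /z !gtn_eqF ?ltnS ?(ltnW jn)// muleC.
Qed.

(** The case [j = n] of [markov_chain_cylinder]: the Markov property as a joint law, which avoids
    conditioning on null events. *)
Lemma markov_chain_step (n : nat) (s t : state) :
  P (Y n @^-1` [set s] `&` Y n.+1 @^-1` [set t]) =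
  (P (Y n @^-1` [set s]) * (p s t)%:E)%E.
Proof.
pose y k := if k == n then s else t.
have yn : y n = s by rewrite /y eqxx.
have yS : y n.+1 = t by rewrite /y gtn_eqF.
transitivity (P [set w | forall k, (n <= k <= n.+1)%N -> Y k w = y k]).
  congr (P _); apply/seteqP; split => w /=.
    move=> [hs ht] k /andP[]; rewrite leq_eqVlt => /predU1P[<-|nk kn].
      by rewrite yn.
    suff -> : k = n.+1 by rewrite yS.
    by apply/eqP; rewrite eqn_leq kn.
  move=> h; split; first by rewrite /= -yn; apply: h; rewrite leqnn leqnSn.
  by rewrite /= -yS; apply: h; rewrite leqnSn leqnn.
rewrite (markov_chain_cylinder y (leqnn n)) yn yS.
congr (P _ * _)%E; apply/seteqP; split => w /= h.
  by rewrite /= -yn; apply: h; rewrite leqnn.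
by move=> k; rewrite -eqn_leq => /eqP <-; rewrite yn.
Qed.

Lemma integral_markov_chain0 (f : state -> R) : (forall s, 0 <= f s) ->
  (\int[P]_w (f (Y 0%N w))%:E = (f x)%:E)%E.
Proof.
move=> f0; case: (hY) => _ P1 _.
have mx : measurable [set w | Y 0%N w = x].
  exact: (preimage_state_measurable (mY 0) [set x]).
have P0 : P (~` [set w | Y 0%N w = x]) = 0%E.
  by rewrite probability_setC// P1 subee.
rewrite (ge0_negligible_integral (N := ~` [set w | Y 0%N w = x]))//; last 3 first.
- exact: measurableC.
- exact: measurable_fun_state.
- by move=> w _; rewrite lee_fin.
rewrite setDE setTI setCK (eq_integral (cst (f x)%:E)); last first.
  by move=> w /[!inE] /= ->.
by rewrite integral_cst// -[RHS]mule1; congr (_ * _)%E; exact: P1.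
Qed.

(** The integral is sliced by the state at time [n], then by the state at time [n.+1];
    [markov_chain_step] factors the mass of each piece. *)
Lemma integral_markov_chain (f : state -> R) (n : nat) :
  (forall s t, 0 <= p s t) -> (forall s, 0 <= f s) ->
  (\int[P]_w (f (Y n.+1 w))%:E =
   \sum_(k <oo) (P (Y n @^-1` [set nth_state k]) *
     \sum_(l <oo) (f (nth_state l) * p (nth_state k) (nth_state l))%:E))%E.
Proof.
move=> p0 f0; rewrite (ge0_integral_state (mY n))//; last 2 first.
- exact/measurable_fun_state.
- by move=> w; rewrite lee_fin.
apply: eq_eseriesr => k _; rewrite setTI (integral_state (mY n.+1))//; last first.
  exact: preimage_state_measurable.
rewrite -[X in (X * _)%E]fineK ?fin_num_measure//; last first.
  exact: preimage_state_measurable.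
rewrite -nneseriesZl; last by move=> l _; rewrite lee_fin mulr_ge0.
apply: eq_eseriesr => l _; rewrite fineK ?fin_num_measure//; last first.
  exact: preimage_state_measurable.
by rewrite markov_chain_step EFinM muleCA.
Qed.

End chain.

(** * The transition operator *)

Section transition_operator.
Context (R : realType) (m : model R) (phi : state -> R).

(** The operator Q in closed form, as a finite combination open to [ring]; [nneseries_trans] links
    it to the kernel [trans]. *)
Definition trans_op (f : state -> R) (x : state) : R :=
  let i := x.1 in
  let a := phi x * (0 < i)%N%:R in
  if x.2 then
    lambda m * f (i.+1, true) + beta m * f (i, false)
    + a * f (i.-1, true) + (1 - lambda m - beta m - a) * f (i, true)
  else
    lambda m * f (i.+1, false)
    + a * f (i.-1, false) + (1 - lambda m - a) * f (i, false).

Hypothesis hphi : policies m phi.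

Let rates : [/\ 0 < lambda m, 0 < beta m, 0 < mu1 m, mu1 m < mu2 m &
  lambda m + mu1 m + mu2 m + beta m = 1].
Proof.
split; [exact: lambda_gt0|exact: beta_gt0|exact: mu1_gt0|exact: mu1_lt_mu2|
exact: total_rate].
Qed.

(** The departure coefficient is 0, [mu1] or [mu2], and all rates sum to 1. The last two bounds are
    the holding probabilities for the two values of the flag; both are stated for every [x], so that
    the flag can be split later. *)
Lemma trans_coef_ge0 (x : state) :
  [/\ 0 <= lambda m, 0 <= beta m, 0 <= phi x * (0 < x.1)%N%:R,
      0 <= 1 - lambda m - beta m - phi x * (0 < x.1)%N%:R
    & 0 <= 1 - lambda m - phi x * (0 < x.1)%N%:R].
Proof.
case: rates => l0 b0 m0 m12 tot; have [h1 h2] := hphi x.1.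
have : phi x = mu1 m \/ phi x = mu2 m.
  by case: x h1 h2 => i [|] //= _ ->; exact: mu_mem.
by case=> ->; case: (0 < x.1)%N; rewrite /= ?mulr1 ?mulr0; split; lra.
Qed.

Lemma trans_ge0 (x y : state) : 0 <= trans m phi x y.
Proof.
have [l0 b0 a0 c0 c1] := trans_coef_ge0 x.
(* Generalising the departure coefficient keeps [mulr_ge0] from splitting it into factors. *)
rewrite /trans; move: (phi x * _) a0 c0 c1 => a a0 c0 c1.
by case: x.2; rewrite ?addr_ge0 ?mulr_ge0.
Qed.

Lemma trans_op_ge0 (f : state -> R) (x : state) :
  (forall s, 0 <= f s) -> 0 <= trans_op f x.
Proof.
move=> f0; have [l0 b0 a0 c0 c1] := trans_coef_ge0 x.
rewrite /trans_op; move: (phi x * _) a0 c0 c1 => a a0 c0 c1.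
by case: x.2; rewrite ?addr_ge0 ?mulr_ge0.
Qed.

Lemma nneseries_trans (f : state -> R) (x : state) : (forall s, 0 <= f s) ->
  (\sum_(l <oo) (f (nth_state l) * trans m phi x (nth_state l))%:E =
   (trans_op f x)%:E)%E.
Proof.
move=> f0; have [l0 b0 a0 c0 c1] := trans_coef_ge0 x.
have Z c s : 0 <= c -> (\sum_(l <oo) (c * (f (nth_state l) *
    (nth_state l == s)%:R))%:E = (c * f s)%:E)%E.
  move=> c0'; rewrite EFinM -(nneseries_state_pred1 s f0) -nneseriesZl//.
  by move=> k _; rewrite lee_fin mulr_ge0.
have N c s k : 0 <= c ->
    (0 <= (c * (f (nth_state k) * (nth_state k == s)%:R))%:E)%E.
  by move=> c0'; rewrite lee_fin !mulr_ge0.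
rewrite /trans /trans_op; case: x.2.
  rewrite !EFinD -!Z// -!nneseriesD; try by move=> k _ _; rewrite ?adde_ge0 ?N.
  by apply: eq_eseriesr => k _; rewrite -!EFinD; congr (_%:E); ring.
  rewrite !EFinD -!Z// -!nneseriesD; try by move=> k _ _; rewrite ?adde_ge0 ?N.
  by apply: eq_eseriesr => k _; rewrite -!EFinD; congr (_%:E); ring.
Qed.

Lemma ler_trans_op (f g : state -> R) (x : state) :
  (forall s, f s <= g s) -> trans_op f x <= trans_op g x.
Proof.
move=> fg; have [l0 b0 a0 c0 c1] := trans_coef_ge0 x.
by rewrite /trans_op; case: x.2; rewrite ?lerD// ler_wpM2l.
Qed.

Lemma trans_opD (f g : state -> R) (x : state) :
  trans_op (fun s => f s + g s) x = trans_op f x + trans_op g x.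
Proof. by rewrite /trans_op; case: x.2; ring. Qed.

Lemma trans_opZ (c : R) (f : state -> R) (x : state) :
  trans_op (fun s => c * f s) x = c * trans_op f x.
Proof. by rewrite /trans_op; case: x.2; ring. Qed.

Lemma iter_trans_opZ (c : R) (f : state -> R) (n : nat) :
  iter n trans_op (fun s => c * f s) = (fun s => c * iter n trans_op f s).
Proof. by elim: n => //= n ->; apply/funext => x; exact: trans_opZ. Qed.

Lemma trans_op_weight (gamma : R) (x : state) : 1 <= gamma ->
  trans_op (weight gamma) x <= gamma * weight gamma x.
Proof.
move=> g1; have [l0 b0 a0 c0 c1] := trans_coef_ge0 x.
have w1 i : (i <= x.1.+1)%N -> gamma ^+ i <= gamma ^+ x.1.+1.
  by move=> ix; rewrite ler_weXn2l.
(* On the states reachable in one step the weight is at most this constant, and Q preserves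
   constants because its coefficients sum to 1. *)
apply: (@le_trans _ _ (trans_op (fun=> gamma ^+ x.1.+1) x)).
  rewrite /trans_op /weight; case: x.2; rewrite ?lerD// ler_wpM2l//=; apply: w1 => //;
  rewrite ?(leq_trans (leq_pred _))//.
rewrite /weight -exprS le_eqVlt; apply/orP; left; apply/eqP.
by rewrite /trans_op; case: x.2; ring.
Qed.

End transition_operator.

(** * From the chain to iterates of the operator *)

Section expected_cost.
Context (R : realType) (m : model R) d (T : measurableType d)
  (P : (state -> R) -> state -> probability T R) (Y : nat -> T -> state)
  (hY : forall phi x, policies m phi ->
     markov_chain (P phi x) Y x (trans m phi)).

(** One step turns the expectation of [f] at time [n.+1] into that of Q f at time [n], so the
    induction keeps [f] general. *)
Lemma integral_chain (phi f : state -> R) (x : state) (n : nat) :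
  policies m phi -> (forall s, 0 <= f s) ->
  (\int[P phi x]_w (f (Y n w))%:E = (iter n (trans_op m phi) f x)%:E)%E.
Proof.
move=> hphi; elim: n f => [|n IH] f f0.
  exact: integral_markov_chain0 (hY x hphi) _ f0.
have Q0 s : 0 <= trans_op m phi f s by exact: trans_op_ge0.
have [mY _ _] := hY x hphi.
rewrite (integral_markov_chain (hY x hphi))//; last exact: trans_ge0.
rewrite iterSr -IH// (integral_state (mY n))//.
apply: eq_eseriesr => k _.
by rewrite nneseries_trans// setTI muleC.
Qed.

Lemma cost_ge0 (phi : state -> R) (x : state) :
  policies m phi -> 0 <= cost m phi x.
Proof.
move=> hphi; apply: addr_ge0; last exact: hold_ge0.
have [h1 h2] := hphi x.1.
have : phi x = mu1 m \/ phi x = mu2 m.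
  by case: x h1 h2 => i [|] //= _ ->; exact: mu_mem.
by case=> ->; [rewrite srate_mu1|exact/ltW/srate_mu2].
Qed.

(** Costs are nonnegative, so the sum and the expectation may be exchanged; from here on the
    probability space is gone. *)
Lemma policy_valueE (alpha : R) (phi : state -> R) (x : state) :
  alpha < 1 -> policies m phi ->
  policy_value m P Y alpha phi x =
  (\sum_(0 <= n <oo)
    ((1 - alpha) ^+ n * iter n (trans_op m phi) (cost m phi) x)%:E)%E.
Proof.
move=> a1 hphi; have [mY _ _] := hY x hphi.
have c0 s : 0 <= cost m phi s by exact: cost_ge0.
have a0 n : 0 <= (1 - alpha) ^+ n by rewrite exprn_ge0// subr_ge0 ltW.
rewrite /policy_value integral_nneseries//; last 2 first.
- move=> n; exact: (measurable_fun_state (mY n)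
    (fun s => (1 - alpha) ^+ n * cost m phi s)).
- by move=> n w _; rewrite lee_fin mulr_ge0.
apply: eq_eseriesr => n _.
rewrite (integral_chain (f := fun s => (1 - alpha) ^+ n * cost m phi s))//.
  by rewrite iter_trans_opZ.
by move=> s; rewrite mulr_ge0.
Qed.

End expected_cost.

(** * Finite-horizon costs and Value Iteration *)

Section value_iteration_bounds.
Context (R : realType) (m : model R) (alpha : R).
Hypothesis alpha_lt1 : alpha < 1.

Let a_ge0 : 0 <= 1 - alpha. Proof. by rewrite subr_ge0 ltW. Qed.

Definition policy_step (phi V : state -> R) (x : state) : R :=
  cost m phi x + (1 - alpha) * trans_op m phi V x.

(** The expected discounted cost of the first [n] steps under [phi]. *)
Definition policy_iter (phi : state -> R) (n : nat) : state -> R :=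
  iter n (policy_step phi) (fun=> 0).

Lemma trans_op0 (phi : state -> R) (x : state) : trans_op m phi (fun=> 0) x = 0.
Proof. by rewrite /trans_op; case: x.2; ring. Qed.

Lemma policy_step0 (phi : state -> R) (x : state) :
  policy_step phi (fun=> 0) x = cost m phi x.
Proof. by rewrite /policy_step trans_op0 mulr0 addr0. Qed.

(** Iteration adds a step at the start of the horizon, the cost series a term at its end; linearity
    of Q reconciles the two. *)
Lemma policy_iterS (phi : state -> R) (n : nat) (x : state) :
  policy_iter phi n.+1 x = policy_iter phi n x
    + (1 - alpha) ^+ n * iter n (trans_op m phi) (cost m phi) x.
Proof.
elim: n x => [|n IH] x.
  by rewrite /policy_iter /= policy_step0 expr0 mul1r add0r.
rewrite -[policy_iter phi n.+1 x]/(policy_step phi (policy_iter phi n) x).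
rewrite -[LHS]/(policy_step phi (policy_iter phi n.+1) x) (funext IH).
by rewrite /policy_step trans_opD trans_opZ exprS /=; ring.
Qed.

Lemma policy_iter_sum (phi : state -> R) (n : nat) (x : state) :
  policy_iter phi n x =
  \sum_(0 <= k < n) (1 - alpha) ^+ k * iter k (trans_op m phi) (cost m phi) x.
Proof.
elim: n => [|n IH]; first by rewrite big_nil.
by rewrite policy_iterS IH big_nat_recr.
Qed.

(** The holding probability [1 - lambda - beta - a] equals [mu1 + (mu2 - a)], which isolates the
    part depending on the action. At [i = 0] the predecessor is [i] itself, so departures there
    count as holding. *)
Lemma policy_step_true (phi V : state -> R) (i : nat) :
  policy_step phi V (i, true) = hold m i
    + (1 - alpha) * (mu1 m * V (i, true) + mu1 m * V (i.-1, true)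
                     + lambda m * V (i.+1, true) + beta m * V (i, false))
    + vi_action_cost m alpha V i (phi (i, true)).
Proof.
rewrite /policy_step /cost /trans_op /vi_action_cost.
have -> : mu1 m = 1 - lambda m - mu2 m - beta m.
  by have := total_rate m; lra.
by case: i => [|i] /=; ring.
Qed.

Lemma vi_step_false (phi V : state -> R) (i : nat) : policies m phi ->
  vi_step m alpha V (i, false) = policy_step phi V (i, false).
Proof.
move=> /(_ i)[_ hi]; rewrite /policy_step /cost /trans_op /vi_step /= hi.
by case: i {hi} => [|i] /=; ring.
Qed.

Lemma vi_step_le (phi V : state -> R) (x : state) : policies m phi ->
  vi_step m alpha V x <= policy_step phi V x.
Proof.
case: x => i [|] hphi; last by rewrite (vi_step_false _ _ hphi).
rewrite policy_step_true /vi_step /= lerD2l ge_min.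
by have [[->|->] _] := hphi i; rewrite lexx ?orbT.
Qed.

Lemma policies_vi_greedy (V : state -> R) : policies m (vi_greedy m alpha V).
Proof.
by move=> i; split=> //; rewrite /vi_greedy /=; case: ifP; [left|right].
Qed.

Lemma vi_step_greedy (V : state -> R) (x : state) :
  vi_step m alpha V x = policy_step (vi_greedy m alpha V) V x.
Proof.
case: x => i [|]; last exact/vi_step_false/policies_vi_greedy.
rewrite policy_step_true /vi_step /vi_greedy /=; congr (_ + _).
by case: ifP => h; [exact/min_idPl|apply/min_idPr/ltW; rewrite ltNge h].
Qed.

Lemma policy_step_ge0 (phi V : state -> R) (x : state) :
  policies m phi -> (forall s, 0 <= V s) -> 0 <= policy_step phi V x.
Proof.
move=> hphi V0; apply: addr_ge0; first exact: cost_ge0.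
by apply: mulr_ge0 => //; exact: trans_op_ge0.
Qed.

Lemma vi_value_ge0 (n : nat) (x : state) : 0 <= vi_value m alpha n x.
Proof.
elim: n x => [|n IH] x //=; rewrite vi_step_greedy.
exact: policy_step_ge0 (policies_vi_greedy _) IH.
Qed.

Lemma vi_value_le_policy_iter (phi : state -> R) (n : nat) (x : state) :
  policies m phi -> vi_value m alpha n x <= policy_iter phi n x.
Proof.
move=> hphi; elim: n x => //= n IH x; apply: le_trans (vi_step_le _ _ hphi) _.
by rewrite lerD2l ler_wpM2l// ler_trans_op.
Qed.

(** The states [(i, false)] are never left again, and the rate there is [mu] under every policy. *)
Lemma policy_iter_false (phi : state -> R) (n i : nat) : policies m phi ->
  policy_iter phi n (i, false) = vi_value m alpha n (i, false).
Proof.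
move=> hphi; elim: n i => // n IH i; rewrite /= (vi_step_false _ _ hphi).
by rewrite /policy_step /trans_op /= -!IH.
Qed.

(** * Error bounds in the weighted norm *)

Variables (gamma uM : R).
Hypotheses (gamma_gt1 : 1 < gamma) (gamma_lt : gamma < 1 / (1 - alpha)).
Hypothesis huM : (ereal_sup [set ereal_sup
    [set (`|cost m phi x| / weight gamma x)%:E | x in [set: state]]
  | phi in policies m] <= uM%:E)%E.

Let b := (1 - alpha) * gamma.

Lemma contraction_gt0 : 0 < b.
Proof. by rewrite mulr_gt0 ?subr_gt0// (lt_trans ltr01). Qed.

Lemma contraction_lt1 : b < 1.
Proof. by move: gamma_lt; rewrite ltr_pdivlMr ?subr_gt0// mulrC. Qed.

Lemma weight_gt0 (x : state) : 0 < weight gamma x.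
Proof. by rewrite exprn_gt0// (lt_trans ltr01). Qed.

Lemma cost_le_weight (phi : state -> R) (x : state) : policies m phi ->
  cost m phi x <= uM * weight gamma x.
Proof.
move=> hphi; rewrite -ler_pdivrMr ?weight_gt0// -lee_fin.
apply: le_trans huM; apply: le_trans (ereal_sup_ubound _); last first.
  by exists phi.
apply: ereal_sup_ubound; exists x => //.
by rewrite ger0_norm//; exact: cost_ge0.
Qed.

(** Serving the empty queue at rate [mu2] costs [srate mu2 > 0], in a state of weight 1. *)
Lemma uM_gt0 : 0 < uM.
Proof.
pose phi (x : state) := if x.2 then mu2 m else mu m.
have hphi : policies m phi by move=> i; split; [right|].
have := cost_le_weight (0%N, true) hphi.
rewrite /cost /phi /weight /= hold0 expr0 mulr1 addr0.
exact/lt_le_trans/srate_mu2.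
Qed.

(** One-sided contraction: Q is monotone and linear, and multiplies the weight by at most
    [gamma]. *)
Lemma policy_step_shift (phi V W : state -> R) (k : R) (x : state) :
  policies m phi -> 0 <= k -> (forall s, V s <= W s + k * weight gamma s) ->
  policy_step phi V x <= policy_step phi W x + b * k * weight gamma x.
Proof.
move=> hphi k0 VW; rewrite /policy_step -[leRHS]addrA lerD2l.
apply: (@le_trans _ _ ((1 - alpha) * (trans_op m phi W x
                                + k * (gamma * weight gamma x)))).
  rewrite ler_wpM2l//; apply: le_trans (ler_trans_op hphi x VW) _.
  rewrite trans_opD trans_opZ lerD2l ler_wpM2l//.
  exact/trans_op_weight/ltW.
by rewrite le_eqVlt; apply/orP; left; apply/eqP; rewrite /b; ring.
Qed.

Lemma vi_valueS_le (n : nat) (x : state) :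
  vi_value m alpha n.+1 x <=
  vi_value m alpha n x + b ^+ n * uM * weight gamma x.
Proof.
have b0 := ltW contraction_gt0; have u0 := ltW uM_gt0.
elim: n x => [|n IH] x.
  rewrite /= vi_step_greedy policy_step0 expr0 mul1r add0r.
  exact/cost_le_weight/policies_vi_greedy.
(* The policy that is greedy for [V_n] is merely admissible for [V_(n+1)]: it bounds [V_(n+2)] from
   above and reproduces [V_(n+1)] exactly. *)
pose phi := vi_greedy m alpha (vi_value m alpha n).
have hphi : policies m phi by exact: policies_vi_greedy.
apply: le_trans (vi_step_le _ _ hphi) _.
rewrite /= vi_step_greedy exprS -[b * _ * _]mulrA -/phi.
by apply: policy_step_shift => //; rewrite mulr_ge0 ?exprn_ge0.
Qed.

(* The deviation bound [uM * b ^+ n / (1 - b)] is a fixed point of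
   [D |-> b * (b ^+ n.-1 * uM + D)] for [n > 0], whence the induction on [k]. *)
Lemma policy_iter_le (phi : state -> R) (n k : nat) (x : state) :
  is_vi_policy m alpha n phi ->
  policy_iter phi k x <=
  vi_value m alpha n x + uM * b ^+ n / (1 - b) * weight gamma x.
Proof.
have b0 := contraction_gt0; have b1 := contraction_lt1; have u0 := uM_gt0.
have b1' : 0 < 1 - b by rewrite subr_gt0.
have D0 : 0 <= uM * b ^+ n / (1 - b).
  by rewrite divr_ge0 ?mulr_ge0 ?exprn_ge0 1?ltW.
move=> hphi; elim: k x => [|k IH] x.
  by rewrite addr_ge0 ?vi_value_ge0// mulr_ge0// ltW ?weight_gt0.
case: n => [|n] in D0 hphi IH *.
  (* Here [V_0 = 0] and [phi] is arbitrary; the bound closes by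
     [uM + b * uM / (1 - b) = uM / (1 - b)]. *)
  apply: le_trans (policy_step_shift x hphi D0 IH) _.
  rewrite policy_step0 add0r; apply: le_trans (lerD (cost_le_weight x hphi) (lexx _)) _.
  rewrite -mulrDl le_eqVlt; apply/orP; left; apply/eqP; congr (_ * _).
  by rewrite expr0; field; rewrite gt_eqF.
rewrite /= in hphi; have pphi : policies m phi.
  by rewrite hphi; exact: policies_vi_greedy.
(* Since [phi] is greedy for [V_n], the induction hypothesis has to be restated relative to [V_n]
   instead of [V_(n+1)], at the price [b ^+ n * uM]. *)
pose D' := b ^+ n * uM + uM * b ^+ n.+1 / (1 - b).
have D'0 : 0 <= D' by rewrite addr_ge0// mulr_ge0 ?exprn_ge0 1?ltW.
have IH' s : policy_iter phi k s <= vi_value m alpha n s + D' * weight gamma s.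
  apply: le_trans (IH s) _; rewrite /D' mulrDl addrA lerD2r.
  exact: vi_valueS_le.
apply: le_trans (policy_step_shift x pphi D'0 IH') _.
rewrite {1}hphi -vi_step_greedy lerD2l le_eqVlt; apply/orP; left; apply/eqP.
by congr (_ * _); rewrite /D' exprS; field; rewrite gt_eqF.
Qed.

End value_iteration_bounds.

(** The exponent is at least [logb b c], also when [Num.max] replaces a negative ceiling by 0; as
    [ln b < 0], the inequality flips. *)
Lemma expr_logb_ceil_le (R : realType) (b c : R) : 0 < b -> b < 1 -> 0 < c ->
  b ^+ absz (Num.max 0 (Num.ceil (logb b c))) <= c.
Proof.
move=> b0 b1 c0; set N := absz _.
have hN : logb b c <= N%:R.
  apply: le_trans (ceil_ge _) _.
  by rewrite -[N%:R]/(N%:Z%:~R) ler_int /N gez0_abs ?le_max lexx ?orbT.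
have lb : ln b < 0 by rewrite ln_lt0// b0.
rewrite -ler_ln ?posrE ?exprn_gt0// lnXn// -mulr_natl.
by rewrite -ler_ndivrMr.
Qed.

(** The two real bounds also exclude an infinite [y]. *)
Lemma lee_abs_subr (R : realType) (a e : R) (y : \bar R) :
  ((a - e)%:E <= y)%E -> (y <= (a + e)%:E)%E -> (`|a%:E - y| <= e%:E)%E.
Proof.
case: y => [r| |]; rewrite ?leye_eq ?leeNy_eq//.
by rewrite /= !lee_fin ler_norml => h1 h2; apply/andP; split; lra.
Qed.

(** * Infinite-horizon values as limits of finite-horizon costs *)

Section policy_value_bounds.
Context (R : realType) (m : model R) d (T : measurableType d)
  (P : (state -> R) -> state -> probability T R) (Y : nat -> T -> state)
  (hY : forall phi x, policies m phi ->
     markov_chain (P phi x) Y x (trans m phi)).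
Variable alpha : R.
Hypothesis alpha_lt1 : alpha < 1.

Let term_ge0 phi x n : policies m phi ->
  (0 <= ((1 - alpha) ^+ n * iter n (trans_op m phi) (cost m phi) x)%:E)%E.
Proof.
move=> hphi; rewrite lee_fin mulr_ge0 ?exprn_ge0 ?subr_ge0 ?(ltW alpha_lt1)//.
elim: n x => [|n IH] x; first exact: cost_ge0.
exact: trans_op_ge0.
Qed.

Lemma policy_iter_le_value (phi : state -> R) (n : nat) (x : state) :
  policies m phi ->
  ((policy_iter m alpha phi n x)%:E <= policy_value m P Y alpha phi x)%E.
Proof.
move=> hphi; rewrite (policy_valueE hY)// policy_iter_sum -sumEFin.
by apply: nneseries_lim_ge => k _ _; exact: term_ge0.
Qed.

Lemma policy_value_le (phi : state -> R) (x : state) (B : R) :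
  policies m phi -> (forall n, policy_iter m alpha phi n x <= B) ->
  (policy_value m P Y alpha phi x <= B%:E)%E.
Proof.
move=> hphi hB; rewrite (policy_valueE hY)//.
apply: lime_le; first by apply: is_cvg_nneseries => k _ _; exact: term_ge0.
by apply: nearW => n; rewrite sumEFin lee_fin -policy_iter_sum.
Qed.

Lemma vi_value_le_policy_value (phi : state -> R) (n : nat) (x : state) :
  policies m phi ->
  ((vi_value m alpha n x)%:E <= policy_value m P Y alpha phi x)%E.
Proof.
move=> hphi; apply: le_trans (policy_iter_le_value n x hphi).
by rewrite lee_fin vi_value_le_policy_iter.
Qed.

End policy_value_bounds.

Theorem mainTheorem5 (R : realType) (m : model R)
  (d : measure_display) (T : measurableType d)
  (P : (state -> R) -> state -> probability T R) (Y : nat -> T -> state)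
  (hY : forall phi x, policies m phi ->
     markov_chain (P phi x) Y x (trans m phi))
  (alpha gamma uM : R)
  (alpha_gt0 : 0 < alpha) (alpha_lt1 : alpha < 1)
  (gamma_gt1 : 1 < gamma) (gamma_lt : gamma < 1 / (1 - alpha))
  (huM : (ereal_sup [set ereal_sup [set (`|cost m phi x| / weight gamma x)%:E
                                   | x in [set: state]]
                    | phi in policies m] <= uM%:E)%E)
  (eps : R) (eps_gt0 : 0 < eps) (i : nat) :
  (let n := n_iter alpha gamma uM eps i in
   (`| (vi_value m alpha n (i, false) - vi_value m alpha n (i, true))%:E
       - saved_cost m P Y alpha i | <= eps%:E)%E)
  /\
  (forall phi, is_vi_policy m alpha (n_iter alpha gamma uM (eps / 2) i) phi ->
   forall j, (j <= i)%N ->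
   (`| policy_value m P Y alpha phi (j, true) - value m P Y alpha (j, true) |
     <= eps%:E)%E).
Proof.
set b := (1 - alpha) * gamma.
pose dev n (x : state) := uM * b ^+ n / (1 - b) * weight gamma x.
have b0 : 0 < b by exact: contraction_gt0.
have b1 : b < 1 by exact: contraction_lt1.
have u0 : 0 < uM by exact: uM_gt0 gamma_gt1 huM.
have g0 : 0 < gamma by exact: lt_trans gamma_gt1.
have b1' : 0 < 1 - b by rewrite subr_gt0.
(* [n_iter] is tuned to queue length [i]; shorter queues have smaller weight. *)
have dev_le e j q : 0 < e -> (j <= i)%N ->
    dev (n_iter alpha gamma uM e i) (j, q) <= e / 2.
  move=> e0 ji; set n := n_iter _ _ _ _ _.
  have gi : 0 < gamma ^+ i by rewrite exprn_gt0.
  have hn : b ^+ n <= e * (1 - b) / (2 * uM * gamma ^+ i).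
    by apply: expr_logb_ceil_le => //; rewrite divr_gt0 ?mulr_gt0.
  apply: (@le_trans _ _ (uM * b ^+ n / (1 - b) * gamma ^+ i)).
    rewrite ler_wpM2l//; last by rewrite /weight ler_weXn2l// ltW.
    by rewrite divr_ge0 ?mulr_ge0 ?exprn_ge0 1?ltW.
  (* This is [dev] at length [i] with [b ^+ n] replaced by the argument of the logarithm in
     [n_iter]. *)
  have -> : e / 2 = uM * (e * (1 - b) / (2 * uM * gamma ^+ i)) / (1 - b)
                    * gamma ^+ i.
    by field; rewrite !gt_eqF.
  by rewrite !ler_pM2r ?invr_gt0// ler_pM2l.
have is_vi_policies n phi : is_vi_policy m alpha n phi -> policies m phi.
  by case: n => //= n ->; exact: policies_vi_greedy.
have lower n phi x : policies m phi ->
    ((vi_value m alpha n x)%:E <= policy_value m P Y alpha phi x)%E.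
  exact: (vi_value_le_policy_value hY).
have upper n phi x : is_vi_policy m alpha n phi ->
    (policy_value m P Y alpha phi x <= (vi_value m alpha n x + dev n x)%:E)%E.
  move=> hphi; apply: (policy_value_le hY) => //.
    exact: is_vi_policies hphi.
  by move=> k; exact: policy_iter_le hphi.
have ex_vi n : exists phi, is_vi_policy m alpha n phi.
  case: n => [|n]; last by eexists.
  by exists (vi_greedy m alpha (fun=> 0)); exact: policies_vi_greedy.
split.
- move=> n; have dn q : dev n (i, q) <= eps / 2 by exact: dev_le.
  have [psi hpsi] := ex_vi n; have ppsi := is_vi_policies _ _ hpsi.
  apply: lee_abs_subr.
    (* The Value Iteration policy [psi] witnesses the lower bound on the supremum. *)
    apply: le_trans (ereal_sup_ubound _); last by exists psi.
    apply: le_trans (leeB (lower n psi (i, false) ppsi)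
                          (upper n psi (i, true) hpsi)).
    by rewrite -EFinB lee_fin; have := dn true; lra.
  apply: ge_ereal_sup => _ [phi hphi <-].
  have hf : (policy_value m P Y alpha phi (i, false) <=
             (vi_value m alpha n (i, false) + dev n (i, false))%:E)%E.
    apply: (policy_value_le hY) => // k.
    (* [upper] covers Value Iteration policies only; at [(i, false)] the costs of [phi] equal those
       of [psi]. *)
    rewrite policy_iter_false// -(policy_iter_false _ k i ppsi).
    exact: policy_iter_le hpsi.
  apply: le_trans (leeB hf (lower n phi (i, true) hphi)) _.
  by rewrite -EFinB lee_fin; have := dn false; lra.
move=> phi hphi j ji; set n := n_iter _ _ _ _ _ in hphi.
have pphi := is_vi_policies _ _ hphi.
(* The optimal value and that of [phi] both lie between [V_n] and [V_n + dev n]. *)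
have dn : dev n (j, true) <= eps / 2 / 2 by apply: dev_le => //; rewrite divr_gt0.
have := upper n phi (j, true) hphi.
have := lower n phi (j, true) pphi.
have : (value m P Y alpha (j, true) <= policy_value m P Y alpha phi (j, true))%E.
  by apply: ereal_inf_lbound; exists phi.
have : ((vi_value m alpha n (j, true))%:E <= value m P Y alpha (j, true))%E.
  apply: le_ereal_inf_tmp => _ [psi ppsi <-].
  exact: lower.
(* The bounds just collected discard all infinite cases. *)
case: (policy_value _ _ _ _ _ _) => [r| |]; rewrite ?leye_eq ?leeNy_eq//.
case: (value _ _ _ _ _) => [s| |]; rewrite ?leye_eq ?leeNy_eq//=.
rewrite !lee_fin => h1 h2 h3 h4; rewrite ler_norml.
by apply/andP; split; lra.
Qed.
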